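(* Let $F=f+\psi-g$ on $\mathbb{R}^n$ satisfy the standing assumptions (A1)–(A4) listed in the context, with positive integers $p,q$ and Lipschitz constants $L_p^f$, $L_q^g$. Let $M_p>L_p^f$ and $M_q>L_q^g$, and let $(x_k)_{k\ge 0}$ be a sequence generated by the HO-DC algorithm (defined in the context) with these parameters. Then: 1. For all $k\ge 0$, $$F(x_{k+1})\le F(x_k)-2\left(\frac{M_p-L_p^f}{(p+1)!}\cdot\frac{M_q-L_q^g}{(q+1)!}\right)^{\frac12}\|x_{k+1}-x_k\|^{\frac{p+q+2}{2}}.$$ 2. $$\sum_{k=0}^{\infty}\|x_{k+1}-x_k\|^{\frac{p+q+2}{2}}<\infty\quad\text{and}\quad \lim_{k\to\infty}\|x_{k+1}-x_k\|=0.$$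
   Context: Problem: minimize $F(x)=f(x)+\psi(x)-g(x)$ over $x\in\mathbb{R}^n$ (Euclidean norm $\|\cdot\|$), with $F=+\infty$ outside $\text{dom}\,F=\text{dom}\,\psi$. Standing assumptions, with $p,q$ positive integers: (A1) $f$ is convex and $p$ times continuously differentiable on $\text{dom}\,\psi$ (derivatives are understood for a function defined on an open convex set containing $\text{dom}\,\psi$), and its $p$-th derivative is Lipschitz on $\text{dom}\,\psi$ with constant $L_p^f>0$: $\|D^pf(x)-D^pf(y)\|\le L_p^f\|x-y\|$ for all $x,y\in\text{dom}\,\psi$. (A2) $g$ is convex and $q$ times continuously differentiable on $\text{dom}\,\psi$ (same convention), and its $q$-th derivative is Lipschitz on $\text{dom}\,\psi$ with constant $L_q^g>0$. (A3) $\psi:\mathbb{R}^n\to\mathbb{R}\cup\{+\infty\}$ is proper, lower semicontinuous and convex, with closed convex domain $\text{dom}\,\psi$. (A4) The problem has a solution, and hence $\inf_{x\in\text{dom}\,\psi}F(x)\ge F^*>-\infty$ for a constant $F^*$. The norm of a symmetric $p$-linear form is $\|D^p\phi\|=\max\{|D^p\phi[h]^p|:\|h\|\le 1\}$, where $D^p\phi[h]^p$ denotes evaluation with all arguments equal to $h$. Taylor approximation: $T_p^{\phi}(y;x)=\phi(x)+\sum_{i=1}^p\frac1{i!}D^i\phi(x)[y-x]^i$. Model: for $x\in\text{dom}\,\psi$ and constants $M_p>L_p^f$, $M_q>L_q^g$ (two separate constants, even if $p=q$), $$m_p^q(y;x)=T_p^f(y;x)+\frac{M_p}{(p+1)!}\|y-x\|^{p+1}+\psi(y)-T_q^g(y;x)+\frac{M_q}{(q+1)!}\|y-x\|^{q+1}.$$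 HO-DC algorithm: choose $x_0\in\text{dom}\,\psi$, $M_p>L_p^f$, $M_q>L_q^g$. For each $k\ge 0$, $x_{k+1}$ is any stationary point of $y\mapsto m_p^q(y;x_k)$, i.e. $0\in\partial m_p^q(x_{k+1};x_k)$ (limiting subdifferential with respect to the first argument), satisfying $m_p^q(x_{k+1};x_k)\le m_p^q(x_k;x_k)=F(x_k)$. A sequence $(x_k)_{k\ge 0}$ is generated by HO-DC if it arises this way. *)

(* Defs.v *)
From HB Require Import structures.
From mathcomp Require Import all_boot all_order all_algebra.
From mathcomp Require Import all_classical all_reals all_analysis.

Set Implicit Arguments.
Unset Strict Implicit.
Unset Printing Implicit Defensive.

Import Order.TTheory GRing.Theory Num.Theory.
Import numFieldNormedType.Exports.

Local Open Scope classical_set_scope.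
Local Open Scope ring_scope.

Section defs.
Context {R : realType} {n : nat}.
Local Notation E := 'rV[R]_n.
Implicit Types (f g : E -> R) (psi h : E -> \bar R) (x y v : E) (U D : set E).

(* The library norm `|x| on 'rV[R]_n is the max norm, hence a separate
   Euclidean norm. Both induce the same topology, so the library notions of
   limit, openness, closedness, differentiability, etc. are used as they are. *)
Definition dotp x y : R := \sum_(i < n) x 0 i * y 0 i.

Definition enorm x : R := Num.sqrt (dotp x x).

(* The form D^i f(x)[h_1, ..., h_i], with hs = [:: h_1; ...; h_i], as an
   iterated directional derivative. *)
Definition Dform f x (hs : seq E) : R :=
  foldr (fun (u : E) (phi : E -> R) => fun z : E => 'D_u phi z) f hs x.

(* Norm of a symmetric p-linear form, computed on the diagonal. The maximum is
   written as a supremum in \bar R, so that it is meaningful without knowing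
   beforehand that the set of values is bounded. *)
Definition form_norm (p : nat) (A : seq E -> R) : \bar R :=
  ereal_sup [set (`|A (nseq p u)|)%:E | u in [set u : E | enorm u <= 1]].

(* In finite dimension, a multilinear-form-valued map is differentiable (resp.
   continuous) iff all its evaluations at fixed directions are. *)
Definition continuously_differentiable (p : nat) U f : Prop :=
  (forall hs : seq E, (size hs < p)%N ->
     forall x, U x -> differentiable (fun z : E => Dform f z hs) x) /\
  (forall hs : seq E, size hs = p ->
     forall x, U x -> {for x, continuous (fun z : E => Dform f z hs)}).

(* f is a total function, but its values matter only on the open set U. *)
Definition convex_smooth (p : nat) D f (L : R) : Prop :=
  [/\ convex_function D f,
      exists U, [/\ open U, convex_set U, D `<=` U &
                    continuously_differentiable p U f],
      0 < L &
      forall x y, D x -> D y ->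
        (form_norm p (fun hs => Dform f x hs - Dform f y hs)%R
           <= (L * enorm (x - y))%:E)%E].

Definition dom psi : set E := [set x | (psi x < +oo)%E].

Definition proper_fun psi : Prop :=
  (forall x, (-oo < psi x)%E) /\ dom psi !=set0.

(* Since 0 * +oo = 0 in \bar R, the cases t = 0 and t = 1 hold
   trivially. *)
Definition econvex psi : Prop :=
  forall x y (t : R), 0 <= t <= 1 ->
    (psi (t *: x + (1 - t) *: y)%R <= t%:E * psi x + (1 - t)%:E * psi y)%E.

Definition proper_lsc_convex psi : Prop :=
  [/\ proper_fun psi, lower_semicontinuous psi, econvex psi,
      closed (dom psi) & convex_set (dom psi)].

Definition objective f psi g x : \bar R := ((f x)%:E + psi x - (g x)%:E)%E.

Definition has_solution f psi g : Prop :=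
  exists2 xs : E, dom psi xs &
    forall x, (objective f psi g xs <= objective f psi g x)%E.

Definition taylor (p : nat) f y x : R :=
  f x + \sum_(1 <= i < p.+1) (i`!%:R)^-1 * Dform f x (nseq i (y - x)).

Definition model (p q : nat) (Mp Mq : R) f psi g y x : \bar R :=
  ((taylor p f y x + Mp / (p.+1)`!%:R * enorm (y - x) ^+ p.+1)%:E
   + psi y
   + (- taylor q g y x + Mq / (q.+1)`!%:R * enorm (y - x) ^+ q.+1)%:E)%E.

(* The Frechet (regular) subdifferential of h at x: the lower limit of
   (h y - h x - <v, y - x>) / ||y - x||, as y tends to x with y != x, is
   nonnegative. It is empty where h is not finite. *)
Definition frechet_subdiff h x : set E :=
  [set v | h x \is a fin_num /\
     (0 <= limf_einf
             (fun y : E => (h y - h x - (dotp v (y - x))%:E)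
                            * ((enorm (y - x))^-1)%:E) x^')%E].

Definition limiting_subdiff h x : set E :=
  [set v | h x \is a fin_num /\
     exists u w : nat -> E,
       [/\ forall k, frechet_subdiff h (u k) (w k),
           u k @[k --> \oo] --> x,
           h (u k) @[k --> \oo] --> h x &
           w k @[k --> \oo] --> v]].

Definition HODC (p q : nat) (Mp Mq : R) f psi g (x : nat -> E) : Prop :=
  dom psi (x 0%N) /\
  forall k : nat,
    limiting_subdiff (fun y => model p q Mp Mq f psi g y (x k)) (x k.+1) 0 /\
    (model p q Mp Mq f psi g (x k.+1) (x k)
       <= model p q Mp Mq f psi g (x k) (x k))%E.

End defs.

(* Main.v *)
(* Restricting f to the segment from x to y reduces the Taylor estimate
   |f y - T_p f (y; x)| <= L / (p+1)! * ||y - x||^(p+1) to one variable, where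
   it follows by comparing derivatives, by induction on p. Applied to f and g,
   it bounds F y by the model at y minus
   (Mp - Lf) / (p+1)! * r^(p+1) + (Mq - Lg) / (q+1)! * r^(q+1), r = ||y - x||,
   and AM-GM turns these two terms into the claimed decrease. Telescoping
   against the minimum of F gives summability. *)
Require Import Defs.
From mathcomp Require Import all_boot all_order all_algebra.
From mathcomp Require Import all_classical all_reals all_analysis.
From mathcomp Require Import ring lra.

Set Implicit Arguments.
Unset Strict Implicit.
Unset Printing Implicit Defensive.

Import Order.TTheory GRing.Theory Num.Theory.
Import numFieldNormedType.Exports.
Local Open Scope classical_set_scope.
Local Open Scope ring_scope.

(** * Directional derivatives along a line *)

Lemma is_derive_line (R : realType) (V : normedModType R) (phi : V -> R)
    (x v : V) (t : R) :
  derivable phi (x + t *: v) v ->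
  is_derive t 1 (fun s : R => phi (x + s *: v)) ('D_v phi (x + t *: v)).
Proof.
move=> dphi.
have E : (fun s : R => s^-1 *: (phi (x + (s *: 1 + t) *: v) - phi (x + t *: v)))
    = (fun s : R => s^-1 *: (phi (s *: v + (x + t *: v)) - phi (x + t *: v))).
  by apply/funext => s; rewrite scalerDl scaler1 addrCA.
split; first by rewrite /derivable /= E.
by rewrite /derive /= E.
Qed.

(** [Dform] is an iterated derivative, not a multilinear form by construction, so homogeneity is
    proved one direction at a time, from linearity of the differential. The inductive identity has
    to hold near [z] in order to be differentiated, hence the open set [U]. This is what reduces a
    direction [y - x] to a unit one. *)
Lemma Dform_nseqZ (R : realType) (n p : nat) (f : 'rV[R]_n -> R)
    (U : set 'rV[R]_n) :
  open U -> continuously_differentiable p U f ->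
  forall (c : R) (u z : 'rV[R]_n) (i : nat), (i <= p)%N -> U z ->
    Dform f z (nseq i (c *: u)) = c ^+ i * Dform f z (nseq i u).
Proof.
move=> oU [df _] c u z i; elim: i z => [|i IH] z ip Uz.
  by rewrite expr0 mul1r.
have dfi : differentiable (fun y => Dform f y (nseq i u)) z.
  by apply: df; rewrite ?size_nseq.
have -> : Dform f z (nseq i.+1 (c *: u)) =
    'D_(c *: u) (c ^+ i \*: (fun y => Dform f y (nseq i u))) z.
  rewrite /Dform /=; apply: near_eq_derive.
  have := open_nbhs_nbhs (conj oU Uz); apply: filterS => y Uy.
  by apply: IH Uy; apply: ltnW.
rewrite deriveZ; last exact: diff_derivable.
by rewrite deriveE // linearZ -deriveE //= scalerA [in RHS]/Dform /= -exprSr.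
Qed.

(** * The Euclidean norm and the norm of a form *)

Section euclidean_norm.
Context {R : realType} {n : nat}.
Implicit Types x : 'rV[R]_n.

Lemma dotp_ge0 x : 0 <= dotp x x.
Proof. by apply: sumr_ge0 => i _; rewrite -expr2 sqr_ge0. Qed.

Lemma enorm_ge0 x : 0 <= enorm x.
Proof. exact: sqrtr_ge0. Qed.

Lemma enorm_eq0 x : enorm x = 0 -> x = 0.
Proof.
move=> /eqP; rewrite sqrtr_eq0 => x0.
have /eqP : dotp x x = 0 by apply/eqP; rewrite eq_le x0 dotp_ge0.
rewrite psumr_eq0 => [/allP x_eq0|i _]; last by rewrite -expr2 sqr_ge0.
apply/rowP => i; rewrite mxE; apply/eqP.
by have := x_eq0 i (mem_index_enum i); rewrite mulf_eq0 orbb.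
Qed.

Lemma enormZ (c : R) x : enorm (c *: x) = `|c| * enorm x.
Proof.
rewrite /enorm.
have -> : dotp (c *: x) (c *: x) = c ^+ 2 * dotp x x.
  by rewrite /dotp mulr_sumr; apply: eq_bigr => i _; rewrite !mxE; ring.
by rewrite sqrtrM ?sqr_ge0 // sqrtr_sqr.
Qed.

Lemma enorm0 : enorm (0 : 'rV[R]_n) = 0.
Proof. by rewrite -(scale0r 0) enormZ normr0 mul0r. Qed.

End euclidean_norm.

Lemma form_norm_bound (R : realType) (n p : nat) (A : seq 'rV[R]_n -> R) (B : R) :
  (form_norm p A <= B%:E)%E ->
  forall u, enorm u <= 1 -> `|A (nseq p u)| <= B.
Proof.
move=> AB u u1; rewrite -lee_fin; apply: le_trans AB.
by apply: ereal_sup_ubound; exists u.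
Qed.

(** * Taylor remainder in one variable *)

Lemma derive_ge0_ndecr (R : realType) (h dh : R -> R) (a b : R) :
  (forall t, a <= t <= b -> is_derive t 1 h (dh t)) ->
  (forall t, a <= t <= b -> 0 <= dh t) ->
  forall t, a <= t <= b -> h a <= h t.
Proof.
move=> hder dh0 t /andP[at_ tb].
have mem_itv s : s \in `]a, b[ -> a <= s <= b.
  by rewrite in_itv /= => /andP[/ltW -> /ltW ->].
apply: (@ger0_derive1_ndecr R h a b) => //.
- by move=> s /mem_itv /hder [].
- by move=> s /mem_itv sab; rewrite derive1E (@derive_val _ _ _ _ _ _ _ (hder s sab)) dh0.
- apply: derivable_within_continuous => s; rewrite in_itv /= => sab.
  by case: (hder s sab).
Qed.

(** [phi i] plays the i-th derivative of [phi 0]. The induction hypothesis for the shifted family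
    bounds the derivative of the remainder; that bound is the derivative of the claimed one, and
    both sides vanish at 0. *)
Lemma taylor_remainder_le (R : realType) (p : nat) (phi : nat -> R -> R) (C : R) :
  (forall i (t : R), (i < p)%N -> 0 <= t <= 1 -> is_derive t 1 (phi i) (phi i.+1 t)) ->
  (forall t : R, 0 <= t <= 1 -> `|phi p t - phi p 0| <= C * t) ->
  forall t : R, 0 <= t <= 1 ->
    `|phi 0%N t - \sum_(i < p.+1) phi i 0 / i`!%:R * t ^+ i| <=
      C / (p.+1)`!%:R * t ^+ p.+1.
Proof.
elim: p phi => [|p IH] phi dphi phiC t t01.
  by rewrite big_ord1 !fact0 !divr1 mulr1 expr1 phiC.
have {}IH := IH (fun i => phi i.+1) (fun i s ip => dphi i.+1 s ip) phiC.
(* Taylor polynomial and bound are encoded as formal polynomials, so that their derivatives are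
   computed algebraically. *)
pose P := \sum_(i < p.+2) (phi i 0 / i`!%:R) *: 'X^i : {poly R}.
have PE s : P.[s] = \sum_(i < p.+2) phi i 0 / i`!%:R * s ^+ i.
  by rewrite horner_sum; apply: eq_bigr => i _; rewrite hornerZ hornerXn.
have dPE s : P^`().[s] = \sum_(i < p.+1) phi i.+1 0 / i`!%:R * s ^+ i.
  rewrite raddf_sum /= horner_sum big_ord_recl derivZ derivXn mulr0n scaler0.
  rewrite horner0 add0r; apply: eq_bigr => i _; rewrite lift0.
  rewrite derivZ hornerZ derivXn hornerMn hornerXn factS natrM /=.
  rewrite -[s ^+ i *+ _]mulr_natr.
  have f0 : i`!%:R != 0 :> R by rewrite pnatr_eq0 -lt0n fact_gt0.
  have i0 : i.+1%:R != 0 :> R by rewrite pnatr_eq0.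
  by field; rewrite f0 /= nat1r i0.
pose Q := (C / (p.+2)`!%:R) *: 'X^(p.+2) : {poly R}.
have QE s : Q.[s] = C / (p.+2)`!%:R * s ^+ p.+2 by rewrite hornerZ hornerXn.
have dQE s : Q^`().[s] = C / (p.+1)`!%:R * s ^+ p.+1.
  rewrite derivZ hornerZ derivXn hornerMn hornerXn factS natrM /=.
  rewrite -[s ^+ _ *+ _]mulr_natr.
  have f0 : (p.+1)`!%:R != 0 :> R by rewrite pnatr_eq0 -lt0n fact_gt0.
  have i0 : p.+2%:R != 0 :> R by rewrite pnatr_eq0.
  by field; rewrite f0 -?natrD ?addn2 ?add2n ?i0.
have P0 : P.[0] = phi 0%N 0.
  rewrite PE big_ord_recl expr0 mulr1 fact0 divr1 big1 ?addr0 // => i _.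
  by rewrite lift0 expr0n mulr0.
have Q0 : Q.[0] = 0 by rewrite QE expr0n mulr0.
have dphi0 (s : R) : 0 <= s <= 1 -> is_derive s 1 (phi 0%N) (phi 1%N s) by apply: dphi.
rewrite -PE -QE ler_norml; apply/andP; split.
(* Lower bound: [h] starts at 0 and has nonnegative derivative. The upper bound below is the same
   with the opposite sign. *)
- pose h := horner Q + (phi 0%N - horner P).
  have := @derive_ge0_ndecr R h
    (fun s => Q^`().[s] + (phi 1%N s - P^`().[s])) 0 1 _ _ t t01.
  rewrite /h !fctE Q0 P0 subrr addr0 => H.
  rewrite -subr_ge0 opprK addrC; apply: H => s s01.
  + by have := dphi0 s s01 => dphis; apply: is_deriveD.
  + have := IH s s01; rewrite -dPE -dQE ler_norml.
    by move=> /andP[]; lra.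
- pose h := horner Q - (phi 0%N - horner P).
  have := @derive_ge0_ndecr R h
    (fun s => Q^`().[s] - (phi 1%N s - P^`().[s])) 0 1 _ _ t t01.
  rewrite /h !fctE Q0 P0 subrr subr0 => H.
  rewrite -subr_ge0; apply: H => s s01.
  + by have := dphi0 s s01 => dphis; apply: is_deriveB.
  + have := IH s s01; rewrite -dPE -dQE ler_norml.
    by move=> /andP[]; lra.
Qed.

(** * Taylor remainder on a convex domain *)

Lemma convex_set_segment (R : realType) (V : lmodType R) (D : set V) (x y : V) (t : R) :
  convex_set D -> D x -> D y -> 0 <= t <= 1 -> D (x + t *: (y - x)).
Proof.
move=> cD Dx Dy t01.
have := cD y x (Itv01 (proj1 (andP t01)) (proj2 (andP t01))).
rewrite !inE => /(_ Dy Dx); congr D.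
rewrite [LHS]/(t *: y + (1 - t) *: x).
by rewrite scalerBl scale1r scalerBr addrCA.
Qed.

Lemma taylor_error_le (R : realType) (n p : nat) (D : set 'rV[R]_n)
    (f : 'rV[R]_n -> R) (L : R) (x y : 'rV[R]_n) :
  convex_smooth p D f L -> convex_set D -> D x -> D y ->
  `|f y - taylor p f y x| <= L / (p.+1)`!%:R * enorm (y - x) ^+ p.+1.
Proof.
move=> [_ [U [oU _ DU df]] L0 fL] cD Dx Dy; set h := y - x; set r := enorm h.
pose phi i (t : R) := Dform f (x + t *: h) (nseq i h).
have Dseg (t : R) : 0 <= t <= 1 -> D (x + t *: h) by exact: convex_set_segment.
have dphi i (t : R) : (i < p)%N -> 0 <= t <= 1 ->
    is_derive t 1 (phi i) (phi i.+1 t).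
  move=> ip /Dseg/DU Ut; apply: is_derive_line; apply: diff_derivable.
  by apply: df.1; rewrite ?size_nseq.
(* The factor [r ^+ p] comes from homogeneity in the direction, the remaining [t * r] is the
   distance from [x + t *: h] to [x]. *)
have phiL (t : R) : 0 <= t <= 1 -> `|phi p t - phi p 0| <= L * r ^+ p.+1 * t.
  move=> t01; have Dt := Dseg t t01; have /andP[t0 _] := t01.
  (* [form_norm] controls only the unit ball, so [h] is normalised; this excludes [r = 0], where
     [phi p] is constant. *)
  have [r0|rn0] := eqVneq r 0.
    rewrite /phi (enorm_eq0 r0) !scaler0 subrr normr0.
    by rewrite !mulr_ge0 ?exprn_ge0 ?enorm_ge0 // ltW.
  have hE : h = r *: (r^-1 *: h) by rewrite scalerA divff // scale1r.
  have phiE (s : R) : 0 <= s <= 1 ->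
      phi p s = r ^+ p * Dform f (x + s *: h) (nseq p (r^-1 *: h)).
    by move=> /Dseg/DU Us; rewrite /phi {2}hE (Dform_nseqZ oU df).
  rewrite !phiE // ?lexx ?ler01 // scale0r addr0 -mulrBr normrM.
  rewrite ger0_norm ?exprn_ge0 ?enorm_ge0 //.
  have -> : L * r ^+ p.+1 * t = r ^+ p * (L * (t * r)) by rewrite exprS; ring.
  apply: ler_wpM2l; first by rewrite exprn_ge0 ?enorm_ge0.
  have := fL _ _ Dt Dx; rewrite addrAC subrr add0r enormZ (ger0_norm t0) => fLt.
  apply: (form_norm_bound fLt).
  by rewrite enormZ ger0_norm ?invr_ge0 ?enorm_ge0 // mulVf.
have := taylor_remainder_le dphi phiL (t := 1); rewrite ler01 lexx => /(_ isT).
rewrite expr1n mulr1 [_ / _ * _]mulrAC.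
congr (`|_ - _| <= _).
  by rewrite /phi scale1r /h addrC subrK.
rewrite /taylor big_ord_recl expr1n mulr1 fact0 divr1 /phi scale0r addr0.
congr (_ + _); rewrite big_add1 big_mkord.
by apply: eq_bigr => i _; rewrite lift0 expr1n mulr1 mulrC.
Qed.

(** The remainder bound at [y = x] is zero; this avoids evaluating [Dform] in the direction 0. *)
Lemma taylor_self (R : realType) (n p : nat) (f : 'rV[R]_n -> R) (x : 'rV[R]_n)
    (D : set 'rV[R]_n) (L : R) :
  convex_smooth p D f L -> convex_set D -> D x -> taylor p f x x = f x.
Proof.
move=> fL cD Dx; apply/eqP; rewrite eq_sym -subr_eq0 -normr_le0.
apply: le_trans (taylor_error_le fL cD Dx Dx) _.
by rewrite subrr enorm0 expr0n mulr0.
Qed.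

Lemma powR_half_nat (R : realType) (r : R) (m : nat) :
  0 <= r -> r `^ (m%:R / 2) = Num.sqrt (r ^+ m).
Proof.
by move=> r0; rewrite powRrM powR_mulrn // powR12_sqrt // exprn_ge0.
Qed.

(** With A and B the two terms on the right, the left side is 2 sqrt(A B), and (sqrt A - sqrt B)^2
    is nonnegative. *)
Lemma agm_powR (R : realType) (a b r : R) (p q : nat) :
  0 <= a -> 0 <= b -> 0 <= r ->
  2 * (a * b) `^ (1 / 2) * r `^ ((p + q + 2)%:R / 2) <=
    a * r ^+ p.+1 + b * r ^+ q.+1.
Proof.
move=> a0 b0 r0; rewrite div1r powR12_sqrt ?mulr_ge0 // powR_half_nat //.
have A0 : 0 <= a * r ^+ p.+1 by rewrite mulr_ge0 ?exprn_ge0.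
have B0 : 0 <= b * r ^+ q.+1 by rewrite mulr_ge0 ?exprn_ge0.
rewrite -mulrA -sqrtrM ?mulr_ge0 //.
have -> : a * b * r ^+ (p + q + 2) = a * r ^+ p.+1 * (b * r ^+ q.+1).
  by rewrite -[p.+1]addn1 -[q.+1]addn1 !exprD; ring.
rewrite sqrtrM //.
rewrite -{2}[a * _]sqr_sqrtr // -{2}[b * _]sqr_sqrtr //.
have := sqr_ge0 (Num.sqrt (a * r ^+ p.+1) - Num.sqrt (b * r ^+ q.+1)).
by rewrite sqrrB; lra.
Qed.

(** * Summability from sufficient decrease *)

Section summable_decrease.
Context {R : realType}.
Context (F s : nat -> R) (c m : R).
Context (c_gt0 : 0 < c) (s_ge0 : forall k, 0 <= s k).
Context (F_decr : forall k, F k.+1 <= F k - c * s k).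
Context (F_ge : forall k, m <= F k).

Lemma series_decrease_le N : series s N <= (F 0%N - m) / c.
Proof.
rewrite ler_pdivlMr // mulrC.
have : c * series s N <= F 0%N - F N.
  elim: N => [|N IH]; first by rewrite /series /= big_geq // mulr0 subrr.
  by rewrite seriesSr mulrDr; have := F_decr N; lra.
by have := F_ge N; lra.
Qed.

Lemma nneseries_decrease_lty : (\sum_(0 <= k <oo) (s k)%:E < +oo)%E.
Proof.
apply: (@le_lt_trans _ _ ((F 0%N - m) / c)%:E); last exact: ltry.
apply: lime_le.
  by apply: is_cvg_nneseries => k _ _; rewrite lee_fin.
by near=> N; rewrite sumEFin lee_fin series_decrease_le.
Unshelve. all: by end_near. Qed.

Lemma cvg_decrease_0 : s k @[k --> \oo] --> 0.
Proof.
apply: cvg_series_cvg_0; apply: nondecreasing_is_cvgn.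
  by apply: nondecreasing_series.
by exists ((F 0%N - m) / c) => _ [N _ <-]; exact: series_decrease_le.
Qed.

End summable_decrease.

(** By monotonicity of the power, [r k] at least [d] would force its power to be at least the power
    of [d], a positive threshold. *)
Lemma cvg_powR_cvg0 (R : realType) (r : nat -> R) (e : R) :
  0 < e -> (forall k, 0 <= r k) ->
  r k `^ e @[k --> \oo] --> 0 -> r k @[k --> \oo] --> 0.
Proof.
move=> e0 r0 /cvgr0Pnorm_lt re; apply/cvgr0Pnorm_lt => d d0.
have := re _ (powR_gt0 e d0); apply: filterS => k.
rewrite !ger0_norm ?powR_ge0 //; apply: contraTT; rewrite -!leNgt => dr.
by apply: ge0_ler_powR; rewrite ?nnegrE ?(ltW e0) ?(ltW d0).
Qed.

Lemma dom_fineK (R : realType) (n : nat) (psi : 'rV[R]_n -> \bar R) x :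
  proper_fun psi -> dom psi x -> psi x = (fine (psi x))%:E.
Proof.
by move=> [psiNy _] xD; rewrite fineK // fin_numElt psiNy.
Qed.

(** * Descent for one step of the algorithm *)

Section descent.
Context {R : realType} {n p q : nat}.
Context (f g : 'rV[R]_n -> R) (psi : 'rV[R]_n -> \bar R) (Lf Lg Mp Mq : R).
Context (hf : convex_smooth p (dom psi) f Lf)
  (hg : convex_smooth q (dom psi) g Lg) (hpsi : proper_lsc_convex psi).

Lemma model_self x : dom psi x ->
  model p q Mp Mq f psi g x x = objective f psi g x.
Proof.
case: hpsi => [psip _ _ _ cD] Dx.
rewrite /model /objective subrr enorm0 !expr0n /= !mulr0 !addr0.
by rewrite (taylor_self hf cD Dx) (taylor_self hg cD Dx).
Qed.

(** The model at [x] is finite, whereas [psi y = +oo] would make the model at [y] infinite. This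
    keeps the iterates in the domain. *)
Lemma model_le_dom x y : dom psi x ->
  (model p q Mp Mq f psi g y x <= model p q Mp Mq f psi g x x)%E -> dom psi y.
Proof.
case: (hpsi) => [psip _ _ _ cD] Dx; rewrite model_self // /objective.
rewrite (dom_fineK psip Dx) -EFinD /model /dom /=.
by have := psip.1 y; case: (psi y) => [r||] //=.
Qed.

Lemma objective_descent x y : Lf <= Mp -> Lg <= Mq -> dom psi x -> dom psi y ->
  (model p q Mp Mq f psi g y x <= model p q Mp Mq f psi g x x)%E ->
  (objective f psi g y <= objective f psi g x -
     (2 * ((Mp - Lf) / (p.+1)`!%:R * ((Mq - Lg) / (q.+1)`!%:R)) `^ (1 / 2) *
      enorm (y - x) `^ ((p + q + 2)%:R / 2))%:E)%E.
Proof.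
case: (hpsi) => [psip _ _ _ cD] LMf LMg Dx Dy; rewrite model_self //.
rewrite /objective /model (dom_fineK psip Dx) (dom_fineK psip Dy).
rewrite -!EFinD !lee_fin.
have := taylor_error_le hf cD Dx Dy; have := taylor_error_le hg cD Dx Dy.
(* Since [g] enters the objective with a minus sign, its remainder is bounded from below and that of
   [f] from above. *)
rewrite !ler_norml => /andP[gle _] /andP[_ fle] mle.
have a0 : 0 <= (Mp - Lf) / (p.+1)`!%:R by rewrite divr_ge0 ?subr_ge0.
have b0 : 0 <= (Mq - Lg) / (q.+1)`!%:R by rewrite divr_ge0 ?subr_ge0.
have := agm_powR p q a0 b0 (enorm_ge0 (y - x)); rewrite !mulrBl.
by move: gle fle mle; lra.
Qed.

End descent.

Theorem theorem2 (R : realType) (n p q : nat) (hp : (0 < p)%N) (hq : (0 < q)%N)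
  (f g : 'rV[R]_n -> R) (psi : 'rV[R]_n -> \bar R) (Lf Lg Mp Mq : R)
  (hf : convex_smooth p (dom psi) f Lf)
  (hg : convex_smooth q (dom psi) g Lg)
  (hpsi : proper_lsc_convex psi)
  (hsol : has_solution f psi g)
  (hMp : Lf < Mp) (hMq : Lg < Mq)
  (x : nat -> 'rV[R]_n) (hx : HODC p q Mp Mq f psi g x) :
  (forall k : nat,
     (objective f psi g (x k.+1) <=
      objective f psi g (x k) -
      (2 * ((Mp - Lf) / (p.+1)`!%:R * ((Mq - Lg) / (q.+1)`!%:R)) `^ (1 / 2) *
       enorm (x k.+1 - x k) `^ ((p + q + 2)%:R / 2))%:E)%E) /\
  ((\sum_(0 <= k <oo)
      (enorm (x k.+1 - x k) `^ ((p + q + 2)%:R / 2))%:E < +oo)%E /\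
   enorm (x k.+1 - x k) @[k --> \oo] --> 0).
Proof.
have [x0D hxk] := hx.
have xD k : dom psi (x k).
  by elim: k => // k IH; have [_] := hxk k; apply: (model_le_dom hf hg hpsi).
have descent k := objective_descent hf hg hpsi (ltW hMp) (ltW hMq)
  (xD k) (xD k.+1) (hxk k).2.
split; first exact: descent.
have [psip _ _ _ _] := hpsi; have [xs xsD xs_min] := hsol.
(* Real-valued version of the objective, equal to it on the domain, where all iterates and the
   minimiser lie. *)
pose F y := f y + fine (psi y) - g y.
have FE y : dom psi y -> objective f psi g y = (F y)%:E.
  by move=> yD; rewrite /objective (dom_fineK psip yD).
set c := 2 * _ `^ _ in descent.
pose s k := enorm (x k.+1 - x k) `^ ((p + q + 2)%:R / 2).
(* The strict inequalities [Lf < Mp] and [Lg < Mq] make [c] positive, so the telescoped bound can be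
   divided by it. *)
have c_gt0 : 0 < c.
  by rewrite mulr_gt0 // powR_gt0 // mulr_gt0 // divr_gt0 ?subr_gt0 // ltr0n fact_gt0.
have s_ge0 k : 0 <= s k by exact: powR_ge0.
have F_decr k : F (x k.+1) <= F (x k) - c * s k.
  by have := descent k; rewrite !FE // -EFinB lee_fin.
have F_ge k : F xs <= F (x k) by have := xs_min (x k); rewrite !FE // lee_fin.
split; first exact: (@nneseries_decrease_lty _ (F \o x) s c (F xs)).
apply: (@cvg_powR_cvg0 _ _ ((p + q + 2)%:R / 2)) => [|k|].
- by rewrite divr_gt0 // ltr0n addn2.
- exact: enorm_ge0.
- exact: (@cvg_decrease_0 _ (F \o x) s c (F xs)).
Qed.
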